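(* Let $n\ge2$, let $I$ be an ideal of $\Phi_{A_{n-1}}$ such that $I^c$ is full, let $\mathcal{A}_I=\{\{x\in\mathbb{R}^n:x_i-x_j=0\}: e_i-e_j\in I^c\}$, let $A^{(1)}|\dots|A^{(r)}$ be the partition of $[n]$ in accordance with $I$, and let $R^{(u)}=\{v\in\{u+1,\dots,r\}: s_I(A^{(u)})\cap s_I(A^{(v)})\ne\emptyset\}$. Then for every odd prime $p$, $$\bar\chi_{\mathcal{A}_I}(p,t)=\frac1p\sum_{(a^{(u)}_s)}\ \prod_{u=1}^r\binom{\#A^{(u)}}{a^{(u)}_1,\dots,a^{(u)}_p}\ \cdot\ t^{\sum_{u=1}^r\sum_{s=1}^p\left(\binom{a^{(u)}_s}{2}+a^{(u)}_s\sum_{v\in R^{(u)}}a^{(v)}_s\right)},$$ where the sum runs over all families of nonnegative integers $(a^{(u)}_s)_{u\in[r],\,s\in[p]}$ with $a^{(u)}_1+\dots+a^{(u)}_p=\#A^{(u)}$ for each $u\in[r]$.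
   Context: $\Phi^+_{A_{n-1}}=\{e_i-e_j:1\le i<j\le n\}$ with simple roots $e_i-e_{i+1}$, $i\in[n-1]$. The partial order $\preceq$: $e_i-e_j\preceq e_{i'}-e_{j'}$ iff $i'\le i$ and $j\le j'$. An ideal is a subset $I\subseteq\Phi^+_{A_{n-1}}$ with $u\in I$, $u\preceq v\Rightarrow v\in I$; $I^c=\Phi^+_{A_{n-1}}\setminus I$. $I^c$ is full if it contains every simple root. Let $e_{i_1}-e_{j_1},\dots,e_{i_k}-e_{j_k}$ be the maximal elements of $I^c$. The signature of $u\in[n]$ is $s_I(u)=\{l\in[k]: i_l\le u\le j_l\}$. The partition of $[n]$ in accordance with $I$ is the partition $A^{(1)}|\dots|A^{(r)}$ into the maximal nonempty subsets on which $s_I$ is constant, indexed so that $\min A^{(1)}<\dots<\min A^{(r)}$; $s_I(A^{(u)})$ is the common value of $s_I$ on $A^{(u)}$. For a subarrangement $\mathcal{B}$, $\mathrm{r}(\mathcal{B})=n-\dim\bigcap\mathcal{B}$ (with $\bigcap\emptyset=\mathbb{R}^n$). The coboundary polynomial is $\bar\chi_{\mathcal{A}}(q,t)=\sum_{\mathcal{B}\subseteq\mathcal{A}}q^{\mathrm{r}(\mathcal{A})-\mathrm{r}(\mathcal{B})}(t-1)^{\#\mathcal{B}}$. *)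

(* Defs.v *)
From HB Require Import structures.
From mathcomp Require Import all_boot all_order all_algebra.
Set Implicit Arguments. Unset Strict Implicit. Unset Printing Implicit Defensive.
Import GRing.Theory Num.Theory.

(* Indices of [n] are represented 0-based by 'I_n; the root e_i - e_j is the
   pair (i, j) with i < j. *)

Definition root_le n (e f : 'I_n * 'I_n) : bool := (f.1 <= e.1) && (e.2 <= f.2).

Definition posroots n : {set 'I_n * 'I_n} := [set e : 'I_n * 'I_n | (e.1 < e.2)%N].

Definition is_ideal n (I : {set 'I_n * 'I_n}) : bool :=
  (I \subset posroots n) &&
  [forall u, forall v, [&& u \in I, v \in posroots n & root_le u v] ==> (v \in I)].

Definition compl_ideal n (I : {set 'I_n * 'I_n}) : {set 'I_n * 'I_n} :=
  posroots n :\: I.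

Definition is_full n (Ic : {set 'I_n * 'I_n}) : bool :=
  [forall i : 'I_n, forall j : 'I_n, (j == i.+1 :> nat) ==> ((i, j) \in Ic)].

Definition maxel n (Ic : {set 'I_n * 'I_n}) : {set 'I_n * 'I_n} :=
  [set e in Ic | [forall f in Ic, root_le e f ==> (f == e)]].

(* signature s_I(x): maximal elements e_i - e_j of I^c with i <= x <= j
   (indexed by the maximal elements themselves rather than by l in [k]) *)
Definition signature n (I : {set 'I_n * 'I_n}) (x : 'I_n) : {set 'I_n * 'I_n} :=
  [set e in maxel (compl_ideal I) | ((e.1 : nat) <= x)%N && ((x : nat) <= e.2)%N].

(* minimal elements of the blocks (maximal subsets where s_I is constant),
   listed in increasing order *)
Definition block_reps n (I : {set 'I_n * 'I_n}) : seq 'I_n :=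
  [seq u : 'I_n <- enum 'I_n |
     [forall x : 'I_n, ((x : nat) < u)%N ==> (signature I x != signature I u)]].

Definition nblocks n (I : {set 'I_n * 'I_n}) : nat := size (block_reps I).

(* A^(u+1), 0-based u *)
Definition block n (I : {set 'I_n * 'I_n}) (u : nat) : {set 'I_n} :=
  nth set0 [seq [set x | signature I x == signature I y] | y <- block_reps I] u.

Definition block_sig n (I : {set 'I_n * 'I_n}) (u : nat) : {set 'I_n * 'I_n} :=
  nth set0 [seq signature I y | y <- block_reps I] u.

Definition Rset n (I : {set 'I_n * 'I_n}) (u : 'I_(nblocks I)) :
  {set 'I_(nblocks I)} :=
  [set v : 'I_(nblocks I) | (u < v) && (block_sig I u :&: block_sig I v != set0)].

Arguments Rset {n} I u.

(* The hyperplane {x : x_i - x_j = 0} of R^n (row vectors), as the row space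
   of the kernel of the column vector e_i - e_j. *)
Definition hyp (R : fieldType) n (e : 'I_n * 'I_n) : 'M[R]_n :=
  kermx (\col_k ((k == e.1)%:R - (k == e.2)%:R : R))%R.

Definition inter (R : fieldType) n (B : {set 'I_n * 'I_n}) : 'M[R]_n :=
  (\big[capmx/1%:M]_(e in B) hyp R e)%R.

Definition rk (R : fieldType) n (B : {set 'I_n * 'I_n}) : nat :=
  (n - \rank (inter R B))%N.

Definition coboundary (R : fieldType) n (A : {set 'I_n * 'I_n}) (q : R) : {poly R} :=
  \sum_(B : {set 'I_n * 'I_n} | B \subset A)
     ((q ^+ (rk R A - rk R B)) *: ('X - 1) ^+ #|B|)%R.

(* multinomial coefficient binom(m; a_1..a_p) (used when sum a = m) *)
Definition multinom (m : nat) p (a : 'I_p -> nat) : nat :=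
  m`! %/ \prod_(s < p) (a s)`!.

(* right-hand side; families (a^(u)_s) are finite functions, entries bounded
   by n (automatic, since a^(u)_s <= #A^(u) <= n) *)
Definition rhs (R : fieldType) n (I : {set 'I_n * 'I_n}) p : {poly R} :=
  ((p%:R)^-1 *:
  \sum_(a : {ffun 'I_(nblocks I) * 'I_p -> 'I_n.+1} |
          [forall u : 'I_(nblocks I), \sum_(s < p) (a (u, s) : nat) == #|block I u|])
    ((\prod_(u < nblocks I) multinom #|block I u| (fun s => a (u, s)))%:R *:
     'X^(\sum_(u < nblocks I) \sum_(s < p)
            ('C(a (u, s), 2) + a (u, s) * \sum_(v in Rset I u) (a (v, s) : nat))%N)))%R.

Arguments hyp R {n} e.
Arguments inter R {n} B.
Arguments rk R {n} B.
Arguments coboundary R {n} A q.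
Arguments rhs R {n} I p.

(* Main.v *)
Require Import Defs.
From HB Require Import structures.
From mathcomp Require Import all_boot all_order all_algebra.
From mathcomp Require Import zify.
Import GRing.Theory Num.Theory.

(** Let [c(B)] be the number of components of the graph on [n] with edge set [B].
    The flat of [B] has dimension [c(B)], and [p ^ c(B)] is the number of maps
    [f : [n] -> [p]] that are constant on the edges of [B]. Exchanging the sum over
    [B] with the sum over [f] turns the coboundary polynomial into
    [p^-1 * \sum_f t ^ m(f)], where [m(f)] counts the roots of [I^c] that are
    monochromatic for [f]. For [x < y], the root [(x, y)] lies in [I^c] iff the
    signatures of [x] and [y] meet, so [m(f)] only depends on the numbers of
    elements of each block having each colour; the multinomial coefficients count
    the maps [f] with prescribed such numbers. *)

(** * Flats and colourings attached to a set of roots *)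

(** Here [c] sends a vertex to its component and [d] picks a representative. As [T] is quantified
    last, one [k] serves both colourings ([T] = ['I_p]) and vectors ([T] = [R]). *)
Lemma components n (B : {set 'I_n * 'I_n}) :
  exists k (c : 'I_n -> 'I_k) (d : 'I_k -> 'I_n), cancel d c /\
    forall (T : Type) (f : 'I_n -> T),
      (forall e, e \in B -> f e.1 = f e.2) <-> (forall x, f x = f (d (c x))).
Proof.
pose e := [rel x y : 'I_n | ((x, y) \in B) || ((y, x) \in B)].
have se : connect_sym e by apply: sym_connect_sym => x y /=; rewrite orbC.
pose sT := {x : 'I_n | roots e x}.
exists #|{: sT}|, (fun x => enum_rank (Sub (fingraph.root e x) (roots_root se x) : sT)).
exists (fun i => val (enum_val i)); split.
  move=> i; apply: (canLR enum_valK); apply: val_inj => /=.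
  exact/eqP/(valP (enum_val i)).
move=> T f; split=> [fB x | fd [x y] xyB].
  rewrite enum_rankK /=.
  (* Induction along a path from [x] to its root: each edge preserves [f]. *)
  have /connectP[s] := connect_root e x.
  elim: s x (fingraph.root e x) => [|y s IH] x r /= => [_ -> // | /andP[xy ys] lr].
  rewrite -(IH y r ys lr).
  by case/orP: xy => /fB.
rewrite /= (fd x) (fd y) !enum_rankK /=; congr f.
by apply/(fingraph.rootP se)/connect1; rewrite /= xyB.
Qed.

Definition colorings n p (B : {set 'I_n * 'I_n}) : {set {ffun 'I_n -> 'I_p}} :=
  [set f : {ffun 'I_n -> 'I_p} | [forall e in B, f e.1 == f e.2]].

(** Since [d] is a section of [c], composition with [c] is a bijection from the maps ['I_k -> 'I_p]
    to the colourings. *)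
Lemma card_colorings n (B : {set 'I_n * 'I_n}) p k (c : 'I_n -> 'I_k)
    (d : 'I_k -> 'I_n) : cancel d c ->
  (forall f : 'I_n -> 'I_p,
      (forall e, e \in B -> f e.1 = f e.2) <-> (forall x, f x = f (d (c x)))) ->
  #|colorings n p B| = p ^ k.
Proof.
move=> dK fP; rewrite -[p in RHS]card_ord -[k in RHS]card_ord -card_ffun.
have inj : injective (fun g : {ffun 'I_k -> 'I_p} => [ffun x => g (c x)]).
  move=> g h /ffunP gh; apply/ffunP=> i.
  by have := gh (d i); rewrite !ffunE dK.
rewrite -cardsT -(card_imset _ inj); congr #|pred_of_set _|.
apply/setP=> f; rewrite inE; apply/forall_inP/imsetP => [fB | [g _ ->] e eB].
  have {}fB := (fP f).1 (fun e eB => eqP (fB e eB)).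
  exists [ffun i => f (d i)]; first by rewrite inE.
  by apply/ffunP=> x; rewrite !ffunE.
apply/eqP; apply: ((fP _).2) eB => x.
by rewrite !ffunE dK.
Qed.

Lemma sub_interP (R : fieldType) n (B : {set 'I_n * 'I_n}) (u : 'rV[R]_n) :
  reflect (forall e, e \in B -> u 0%R e.1 = u 0%R e.2) (u <= inter R B)%MS.
Proof.
have hE e : (u <= hyp R e)%MS = (u 0%R e.1 == u 0%R e.2).
  rewrite -subr_eq0; apply/sub_kermxP/eqP => [/matrixP/(_ 0%R 0%R) | ue].
    rewrite !mxE => <-.
    under eq_bigr do rewrite mxE mulrBr !mulr_natr !mulrb.
    by rewrite sumrB -!big_mkcond /= !big_pred1_eq.
  apply/matrixP=> i j; rewrite !ord1 !mxE -[RHS]ue.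
  under eq_bigr do rewrite mxE mulrBr !mulr_natr !mulrb.
  by rewrite sumrB -!big_mkcond /= !big_pred1_eq.
apply: (iffP sub_bigcapmxP) => uB e eB.
  by apply/eqP; rewrite -hE uB.
by rewrite hE uB.
Qed.

(** The rows of [M], the indicators of the fibres of [c], form a basis of the flat. *)
Lemma rank_inter (R : fieldType) n (B : {set 'I_n * 'I_n}) k (c : 'I_n -> 'I_k)
    (d : 'I_k -> 'I_n) : cancel d c ->
  (forall f : 'I_n -> R,
      (forall e, e \in B -> f e.1 = f e.2) <-> (forall x, f x = f (d (c x)))) ->
  \rank (inter R B) = k.
Proof.
move=> dK fP.
pose M : 'M[R]_(k, n) := (\matrix_(i, x) (c x == i)%:R)%R.
have MF : row_free M.
  apply/row_freeP; exists (\matrix_(x, i) (x == d i)%:R)%R.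
  apply/matrixP=> i j; rewrite !mxE (bigD1 (d j)) //= !mxE dK eqxx mulr1.
  rewrite big1 ?addr0 1?eq_sym // => x /negPf xd.
  by rewrite !mxE xd mulr0.
rewrite -(eqP MF); apply/eqmx_rank/andP; split.
  apply/row_subP=> i.
  have /sub_interP/(fP (fun x => row i (inter R B) 0%R x)) uE := row_sub i (inter R B).
  (* The coordinates of [u] in this basis are its values at the representatives. *)
  set u := row i _ in uE *; apply/submxP; exists (\row_j u 0%R (d j))%R.
  apply/rowP=> x; rewrite [RHS]mxE (bigD1 (c x)) //= !mxE eqxx mulr1.
  rewrite big1 ?addr0 => [|j /negPf jc]; last by rewrite !mxE eq_sym jc mulr0.
  by have := uE x; rewrite !mxE.
apply/row_subP=> i; apply/sub_interP/(fP (fun x => row i M 0%R x)) => x.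
by rewrite !mxE dK.
Qed.

(** * Maps with prescribed fibre sizes *)

(** A sum over [x < n] rather than a cardinal, so that the term at [ord0] splits off in an induction
    on [n]. *)
Definition fibre_size n (T : eqType) (c : 'I_n -> T) (y : T) : nat :=
  \sum_(x < n) (c x == y).

Lemma fibre_sizeE n (T : eqType) (c : 'I_n -> T) y :
  fibre_size n T c y = #|[set x | c x == y]|.
Proof.
by rewrite -sum1_card big_mkcond /=; apply: eq_bigr => x _; rewrite inE; case: eqP.
Qed.

Definition with_head n S (s : S) (g : {ffun 'I_n -> S}) : {ffun 'I_n.+1 -> S} :=
  [ffun i => oapp g s (unlift ord0 i)].

Lemma sum_ffun_with_head n (S : finType) (F : {ffun 'I_n.+1 -> S} -> nat) :
  \sum_f F f = \sum_s \sum_(g : {ffun 'I_n -> S}) F (with_head n S s g).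
Proof.
rewrite pair_big /= (reindex (fun sg => with_head n S sg.1 sg.2)) //=.
exists (fun f => (f ord0, [ffun i => f (lift ord0 i)])) => [[s g] _ | f _] /=.
  rewrite ffunE unlift_none; congr pair.
  by apply/ffunP=> i; rewrite !ffunE liftK.
by apply/ffunP=> i; rewrite !ffunE; case: unliftP => [j|] -> //=; rewrite ffunE.
Qed.

(* With the factorials multiplied out, the induction on [n], which splits on the
   value of [f] at [ord0], needs no divisibility; the divisibility behind
   [multinom] is then the case of a single block. *)
Lemma card_prescribed_fibres (U S : finType) n (b : 'I_n -> U) (a : U * S -> nat) :
  (forall u, \sum_s a (u, s) = fibre_size n U b u) ->
  (\sum_(f : {ffun 'I_n -> S})
      [forall z, fibre_size n _ (fun x => (b x, f x)) z == a z])
    * \prod_z (a z)`! = \prod_u (fibre_size n U b u)`!.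
Proof.
elim: n b a => [|n IH] b a aE.
  have a0 z : a z = 0.
    case: z => u s; have := aE u; rewrite /fibre_size big_ord0 => /eqP.
    by rewrite sum_nat_eq0 => /forallP/(_ s)/eqP.
  have f1 (f : {ffun 'I_0 -> S}) :
      [forall z, fibre_size 0 _ (fun x => (b x, f x)) z == a z].
    by apply/forallP=> z; rewrite a0 /fibre_size big_ord0.
  rewrite (eq_bigr (fun=> 1) (fun f _ => congr1 nat_of_bool (f1 f))).
  rewrite sum1_card card_ffun card_ord expn0 mul1n.
  rewrite big1 => [|z _]; last by rewrite a0.
  by rewrite big1 // => u _; rewrite /fibre_size big_ord0.
rewrite sum_ffun_with_head big_distrl /=.
pose b' i := b (lift ord0 i); pose u0 := b ord0.
have bE u : fibre_size n.+1 U b u = (u0 == u) + fibre_size n U b' u.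
  by rewrite /fibre_size big_ord_recl.
have fE s g z : fibre_size n.+1 _ (fun x => (b x, with_head n S s g x)) z
    = ((u0, s) == z) + fibre_size n _ (fun x => (b' x, g x)) z.
  rewrite /fibre_size big_ord_recl ffunE unlift_none; congr addn.
  by apply: eq_bigr => i _; rewrite ffunE liftK.
(* Once the head has colour [s], the induction hypothesis applies to the counts lowered by one at
   [(u0, s)]; the factorial there loses the factor [a (u0, s)]. Summed over [s], these factors give
   the size of block [u0]. *)
transitivity (\sum_s a (u0, s) * \prod_u (fibre_size n U b' u)`!).
  apply: eq_bigr => s _.
  under eq_bigr do under eq_forallb do rewrite fE.
  have [a0|a_gt0] := posnP (a (u0, s)).
    rewrite a0 mul0n big1 // => g _; apply/eqP; rewrite eqb0; apply/forallPn.
    by exists (u0, s); rewrite eqxx a0.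
  pose a' z := a z - ((u0, s) == z).
  have aa' z : a z = ((u0, s) == z) + a' z.
    by rewrite /a' subnKC //; case: eqP => // <-.
  have a'E u : \sum_s a' (u, s) = fibre_size n U b' u.
    apply: (@addnI (u0 == u)); rewrite -bE -aE.
    under [RHS]eq_bigr do rewrite aa'.
    rewrite big_split /=; congr addn.
    rewrite (bigD1 s) //= big1 => [|s' /negPf ss']; last by rewrite xpair_eqE eq_sym [s == _]eq_sym ss' andbF.
    by rewrite xpair_eqE eqxx andbT addn0.
  rewrite -(IH b' a' a'E) mulnCA; congr muln.
    by apply: eq_bigr => g _; congr nat_of_bool; apply: eq_forallb => z; rewrite aa' eqn_add2l.
  rewrite (bigD1 (u0, s)) //= [in RHS](bigD1 (u0, s)) //= mulnA; congr muln.
    by rewrite /a' eqxx subn1; case: (a _) a_gt0 => //= m _; rewrite factS.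
  by apply: eq_bigr => z /negPf zE; rewrite /a' eq_sym zE subn0.
rewrite -big_distrl /= aE bE eqxx (bigD1 u0) //= [in RHS](bigD1 u0) //= mulnA.
rewrite bE eqxx add1n factS; congr muln.
by apply: eq_bigr => u /negPf uE; rewrite bE eq_sym uE.
Qed.

Lemma multinom_fact m p (a : 'I_p -> nat) : \sum_s a s = m ->
  multinom m a * \prod_s (a s)`! = m`!.
Proof.
move=> am; rewrite divnK //.
have mE u : fibre_size m unit (fun=> tt) u = m.
  by case: u; rewrite /fibre_size (eq_bigr (fun=> 1)) // sum1_card card_ord.
have aE (u : unit) : \sum_s a (u, s).2 = fibre_size m unit (fun=> tt) u by rewrite mE.
have prod_unit (F : unit -> nat) : \prod_u F u = F tt.
  by rewrite (big_pred1 tt) // => -[].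
(* The number of maps is the cofactor that witnesses the divisibility. *)
have := card_prescribed_fibres unit 'I_p m _ (fun z => a z.2) aE.
rewrite prod_unit mE => <-; apply/dvdn_mull.
by rewrite -(pair_bigA _ (fun u s => (a s)`!)) /= prod_unit.
Qed.

Lemma card_prescribed_fibres_multinom (U : finType) p n (b : 'I_n -> U)
    (a : U * 'I_p -> nat) :
  (forall u, \sum_s a (u, s) = fibre_size n U b u) ->
  #|[set f : {ffun 'I_n -> 'I_p} |
       [forall z, fibre_size n _ (fun x => (b x, f x)) z == a z]]|
  = \prod_u multinom (fibre_size n U b u) (fun s => a (u, s)).
Proof.
move=> aE.
have a_gt0 : 0 < \prod_z (a z)`! by apply: prodn_gt0 => z; apply: fact_gt0.
apply/eqP; rewrite -(eqn_pmul2r a_gt0); apply/eqP.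
rewrite -sum1_card big_mkcond /=.
under eq_bigr => f do rewrite inE -[if _ then _ else _]/(nat_of_bool _).
rewrite (card_prescribed_fibres U 'I_p n b a aE).
have -> : \prod_z (a z)`! = \prod_u \prod_s (a (u, s))`!.
  by rewrite pair_big /=; apply: eq_bigr => [[]].
by rewrite -big_split; apply: eq_bigr => u _ /=; rewrite (multinom_fact _ _ (fun s => a (u, s))).
Qed.

(** * Counting monochromatic pairs *)

(* The count does not depend on the strict total order [lt]: this lets one trade
   the order of [n] for an order that lists the blocks one after the other. *)
Lemma count_ordered_pairs (T : finType) (lt P : rel T) :
  (forall x y, x != y -> lt x y = ~~ lt y x) -> irreflexive lt -> symmetric P ->
  (\sum_x \sum_y (lt x y && P x y)).*2 = \sum_x \sum_y ((x != y) && P x y).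
Proof.
move=> ltC lt0 Ps; rewrite -addnn {2}exchange_big -big_split /=.
apply: eq_bigr => x _; rewrite -big_split; apply: eq_bigr => y _ /=.
rewrite (Ps y x); case: eqVneq => [<- | /ltC ->]; first by rewrite lt0.
by case: (lt y x); case: (P x y).
Qed.

(** Twice the left side counts the ordered pairs of distinct elements of [A], that is
    [#|A| * #|A|.-1]. *)
Lemma count_pairs_in_set n (A : {set 'I_n}) :
  \sum_(x < n) \sum_(y < n) ((x < y) && ((x \in A) && (y \in A))) = 'C(#|A|, 2).
Proof.
apply: double_inj.
rewrite (count_ordered_pairs _ (fun x y : 'I_n => x < y) (fun x y => (x \in A) && (y \in A)))
  => [|x y xy|x|x y]; last 1 first.
- by rewrite andbC.
- rewrite -mul2n -mul_bin_diag bin1 //.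
  transitivity (\sum_(x in A) #|A :\ x|).
    rewrite [RHS]big_mkcond; apply: eq_bigr => x _; case: ifP => xA /=.
      rewrite -sum1_card [RHS]big_mkcond; apply: eq_bigr => y _.
      by rewrite !inE eq_sym; case: eqP; case: (y \in A).
    by rewrite big1 // => y _; rewrite andbF.
  rewrite (eq_bigr (fun=> #|A|.-1)) => [|x xA].
    by rewrite sum_nat_const.
  by rewrite (cardsD1 x A) xA.
- by rewrite -leqNgt [RHS]leq_eqVlt (inj_eq (@ord_inj n)) (negPf xy).
- exact: ltnn.
Qed.

Lemma sum_fibre n (T : finType) (c : 'I_n -> T) (G : T -> nat) :
  \sum_z fibre_size n T c z * G z = \sum_x G (c x).
Proof.
under eq_bigr do rewrite big_distrl /=.
rewrite exchange_big; apply: eq_bigr => x _ /=.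
rewrite (bigD1 (c x)) //= eqxx mul1n big1 ?addn0 // => z /negPf zx.
by rewrite eq_sym zx.
Qed.

(** Blocks may interleave in [[n]], so pairs are recounted in the lexicographic order [lt] on
    [(b x, x)]. Then a pair either stays in one block, which gives the binomials, or goes from a
    block [u] to a block [v > u], which gives the products. *)
Lemma count_monochromatic_pairs r p n (b : 'I_n -> 'I_r) (f : 'I_n -> 'I_p)
    (adj : rel 'I_r) : reflexive adj -> symmetric adj ->
  let a := fibre_size n _ (fun x => (b x, f x)) in
  \sum_(x < n) \sum_(y < n) ((x < y) && (adj (b x) (b y) && (f x == f y)))
  = \sum_u \sum_s ('C(a (u, s), 2)
      + a (u, s) * \sum_(v in [set v : 'I_r | (u < v) && adj u v]) a (v, s)).
Proof.
move=> adjR adjS a.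
pose P x y := adj (b x) (b y) && (f x == f y).
pose lt (x y : 'I_n) := (b x < b y) || ((b x == b y) && (x < y)).
have PS : symmetric P by move=> x y; rewrite /P adjS eq_sym.
transitivity (\sum_(x < n) \sum_(y < n) (lt x y && P x y)).
  apply: double_inj.
  rewrite (count_ordered_pairs _ (fun x y : 'I_n => x < y) P) => [|x y xy|x|//].
  - rewrite (count_ordered_pairs _ lt P) // => [x y xy|x]; last by rewrite /lt !ltnn andbF.
    rewrite /lt -[b x == b y]val_eqE -[b y == b x]val_eqE.
    case: (ltngtP (b x) (b y)) => //= _.
    by rewrite -leqNgt [RHS]leq_eqVlt (inj_eq (@ord_inj n)) (negPf xy).
  - by rewrite -leqNgt [RHS]leq_eqVlt (inj_eq (@ord_inj n)) (negPf xy).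
  - exact: ltnn.
under eq_bigr do rewrite big_split /=.
rewrite big_split /=.
transitivity (\sum_(x < n) \sum_(y < n) ((x < y) && ((b x, f x) == (b y, f y)))
   + \sum_(x < n) \sum_(y < n) [&& b x < b y, adj (b x) (b y) & f x == f y]).
  rewrite -big_split; apply: eq_bigr => x _; rewrite -big_split; apply: eq_bigr => y _ /=.
  rewrite /lt /P xpair_eqE -val_eqE.
  case: (ltngtP (b x) (b y)) => [_|_|bxy] /=; rewrite ?andbF ?andbT //=.
  by rewrite (val_inj bxy) adjR addn0.
congr addn.
  rewrite [RHS]pair_big /=.
  under [RHS]eq_bigr => z _.
    rewrite -surjective_pairing /a fibre_sizeE -count_pairs_in_set.
    over.
  rewrite [RHS]exchange_big; apply: eq_bigr => x _ /=.
  rewrite [RHS]exchange_big; apply: eq_bigr => y _ /=.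
  rewrite (bigD1 (b x, f x)) //= !inE eqxx /= big1 => [|z /negPf zx].
    by rewrite addn0 [_ == (b x, f x)]eq_sym.
  by rewrite !inE [_ == z]eq_sym zx andbF.
rewrite [RHS]pair_big /=.
under [RHS]eq_bigr => z _ do rewrite -surjective_pairing.
(* Each [x] contributes the number of elements of its colour in later adjacent blocks. *)
rewrite (sum_fibre _ _ (fun x => (b x, f x))
  (fun z => \sum_(v in [set v : 'I_r | (z.1 < v) && adj z.1 v]) a (v, z.2))).
apply: eq_bigr => x _; rewrite exchange_big; apply: eq_bigr => y _ /=.
rewrite big_mkcond (bigD1 (b y)) //= inE xpair_eqE eqxx big1 => [|v /negPf vy].
  by rewrite addn0 [f y == _]eq_sym andbA; case: ifP.
by rewrite xpair_eqE eq_sym vy if_same.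
Qed.

(** * The list of block signatures *)

Definition block_sigs n (I : {set 'I_n * 'I_n}) :=
  [seq signature I y | y <- block_reps I].

Lemma uniq_block_sigs n (I : {set 'I_n * 'I_n}) : uniq (block_sigs n I).
Proof.
rewrite map_inj_in_uniq; first exact: filter_uniq (enum_uniq _).
move=> x y.
rewrite !mem_filter => /andP[/forallP xm _] /andP[/forallP ym _] xy.
apply/val_inj; case: (ltngtP x y) => // ltxy.
  by have := ym x; rewrite ltxy xy eqxx.
by have := xm y; rewrite ltxy xy eqxx.
Qed.

(** The least [y] with the signature of [x] is a block representative. *)
Lemma signature_in_block_sigs n (I : {set 'I_n * 'I_n}) x : signature I x \in block_sigs n I.
Proof.
case: (arg_minnP (fun y : 'I_n => y : nat) (eqxx (signature I x)
   : (fun y => signature I y == signature I x) x)) => y /eqP yx ymin.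
rewrite -yx; apply: map_f; rewrite mem_filter mem_enum andbT.
apply/forallP=> z; apply/implyP; apply: contraL => /eqP zy.
by rewrite -leqNgt ymin // zy yx.
Qed.

(** * The coboundary polynomial as a sum over colourings *)

(** Expand a product over all of [T], with factor [y + 1] on [S] and [0 + 1] elsewhere: a choice of
    summands is a subset [B], and the zeros discard those not inside [S]. *)
Lemma sum_subsets_exp (R : comNzRingType) (T : finType) (S : {set T}) (y : R) :
  (\sum_(B : {set T} | B \subset S) y ^+ #|B| = (1 + y) ^+ #|S|)%R.
Proof.
transitivity (\prod_i ((if i \in S then y else 0) + 1))%R; last first.
  rewrite -prodr_const [RHS]big_mkcond; apply: eq_bigr => i _.
  by case: ifP => _; rewrite ?add0r // addrC.
rewrite bigA_distr big_mkcond; apply: eq_bigr => B _.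
rewrite -big_mkcond; case: subsetP => [BS|/subsetP/subsetPn[i iB iS]].
  by rewrite -prodr_const; apply: eq_bigr => i /BS ->.
by rewrite (bigD1 i) //= (negPf iS) mul0r.
Qed.

(** Both sides are [p ^ k] for the number [k] of components; this ties the rank over [R] to
    colourings with [p] colours. *)
Lemma card_colorings_rank (R : fieldType) n p (B : {set 'I_n * 'I_n}) :
  #|colorings n p B| = p ^ \rank (inter R B).
Proof.
have [k [c [d [dK fP]]]] := components n B.
by rewrite (rank_inter R n B k c d dK (fP R)) (card_colorings n B p k c d dK (fP _)).
Qed.

Lemma rank_inter_gt0 (R : fieldType) n (B : {set 'I_n * 'I_n}) :
  0 < n -> 0 < \rank (inter R B).
Proof.
move=> n0; have [k [c [d [dK fP]]]] := components n B.
rewrite (rank_inter R n B k c d dK (fP R)).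
exact: leq_ltn_trans (leq0n _) (ltn_ord (c (Ordinal n0))).
Qed.

(** The simple roots join each index to the next, so the graph is connected and the flat is a
    line. *)
Lemma rank_inter_full (R : fieldType) n (A : {set 'I_n * 'I_n}) :
  0 < n -> is_full A -> \rank (inter R A) = 1.
Proof.
move=> n0 /forallP Afull; apply/eqP; rewrite eqn_leq rank_inter_gt0 // andbT.
have [k [c [d [dK fP]]]] := components n A.
rewrite (rank_inter R n A k c d dK (fP R)).
have cA := (fP _ c).2 (fun x => esym (dK (c x))).
have c0 m (mn : m < n) : c (Ordinal mn) = c (Ordinal n0).
  elim: m mn => [|m IH] mn; first by congr c; apply: val_inj.
  rewrite -(IH (ltnW mn)); symmetry; apply: (cA (Ordinal (ltnW mn), Ordinal mn)).
  by have /forallP/(_ (Ordinal mn)) := Afull (Ordinal (ltnW mn)); rewrite eqxx.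
rewrite leqNgt; apply/negP=> k1.
have := dK (Ordinal k1); have := dK (Ordinal (ltnW k1)).
case: (d _) => i ilt; case: (d _) => j jlt; rewrite !c0 => -> /(congr1 val).
by [].
Qed.

(** As the flat of [A] is a line, the exponent of [p] is one less than the dimension of the flat of
    [B]. For fixed [f], the admissible [B] are the subsets of the set of monochromatic roots, over
    which the powers of ['X - 1] add up to a power of ['X]. *)
Lemma coboundary_colorings (R : numFieldType) n p (A : {set 'I_n * 'I_n}) :
  0 < n -> 0 < p -> is_full A ->
  coboundary R A p%:R%R
  = (p%:R^-1 *: \sum_(f : {ffun 'I_n -> 'I_p})
       'X^#|[set e in A | f e.1 == f e.2]|)%R.
Proof.
move=> n0 p0 Afull.
have pE (B : {set 'I_n * 'I_n}) :
    (p%:R ^+ (rk R A - rk R B) = p%:R^-1 * #|colorings n p B|%:R :> R)%R.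
  rewrite (card_colorings_rank R) /rk rank_inter_full // natrX.
  (* The rank lies between 1 and [n], which makes the truncated subtractions in the exponent
     exact. *)
  have := rank_inter_gt0 R n B n0; have := rank_leq_row (inter R B).
  case: (\rank _) => // c cn _.
  rewrite exprS mulKf ?pnatr_eq0 -?lt0n //; congr (_ ^+ _)%R; lia.
rewrite /coboundary; under eq_bigr do rewrite pE -scalerA.
rewrite -scaler_sumr; congr (_ *: _)%R.
under eq_bigr do rewrite scaler_nat -sumr_const.
rewrite (exchange_big_dep xpredT) //=; apply: eq_bigr => f _.
have XE : ('X = 1 + ('X - 1) :> {poly R})%R by rewrite addrC subrK.
rewrite [in RHS]XE -sum_subsets_exp.
apply: eq_bigl => B; rewrite inE; apply/andP/subsetP => [[/subsetP BA /forall_inP Bf] e eB | BS].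
  by rewrite inE BA // Bf.
split; first by apply/subsetP=> e /BS; rewrite inE => /andP[].
by apply/forall_inP=> e /BS; rewrite inE => /andP[].
Qed.

(** * Signatures and blocks of an ideal *)

(** Among the elements of [A] above [e], one of greatest height is maximal; the height contains
    [n - f.1] because going up lowers [f.1]. *)
Lemma maxel_above n (A : {set 'I_n * 'I_n}) e : e \in A ->
  exists2 m, m \in maxel A & root_le e m.
Proof.
move=> eA; have e0 : (e \in A) && root_le e e by rewrite eA /root_le !leqnn.
case: (arg_maxnP (P := fun f => (f \in A) && root_le e f)
  (fun f : 'I_n * 'I_n => f.2 + (n - f.1)) e0) => -[m1 m2] /andP[mA em] mmax.
exists (m1, m2) => //; rewrite inE mA; apply/forall_inP=> -[f1 f2] fA.
apply/implyP=> mf; have {mmax} := mmax (f1, f2).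
move: em mf; rewrite fA /root_le /= => /andP[em1 em2] /andP[mf1 mf2].
rewrite (leq_trans mf1 em1) (leq_trans em2 mf2) => /(_ isT).
have := ltn_ord m1; have := ltn_ord f1.
by rewrite xpair_eqE -!val_eqE /=; lia.
Qed.

(** The complement of [I] is a lower set, so [(x, y)] belongs to it iff some maximal [m] satisfies
    [m.1 <= x < y <= m.2], and this puts [m] in both signatures. *)
Lemma compl_ideal_signature n (I : {set 'I_n * 'I_n}) (x y : 'I_n) :
  is_ideal I -> x < y ->
  ((x, y) \in compl_ideal I) = (signature I x :&: signature I y != set0).
Proof.
move=> /andP[_ /forallP Iup] xy; apply/idP/set0Pn.
  move=> /maxel_above[m mmax /andP[/= m1 m2]]; exists m.
  rewrite inE; apply/andP; split; rewrite inE mmax /=.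
    by rewrite m1 (leq_trans (ltnW xy) m2).
  by rewrite m2 (leq_trans m1 (ltnW xy)).
move=> [m]; rewrite inE => /andP[]; rewrite inE => /andP[mmax /andP[m1 _]].
rewrite inE => /andP[_ /andP[_ m2]].
move: mmax; rewrite inE => /andP[]; rewrite inE => /andP[mI mpos] _.
rewrite !inE xy andbT; apply: contra mI => xyI.
have /forallP/(_ m)/implyP := Iup (x, y); apply.
by rewrite xyI mpos /root_le m1 m2.
Qed.

(** A simple root outside [I] joins [x] to a neighbour, so their signatures meet. *)
Lemma signature_neq0 n (I : {set 'I_n * 'I_n}) x :
  2 <= n -> is_ideal I -> is_full (compl_ideal I) -> signature I x != set0.
Proof.
move=> n2 Iid /forallP full.
have adj (y z : 'I_n) : z = y.+1 :> nat ->
    signature I y :&: signature I z != set0.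
  move=> zy; rewrite -compl_ideal_signature // ?zy //.
  by have /forallP/(_ z)/implyP := full y; apply; apply/eqP.
case: (ltnP x.+1 n) => [x1n | nx].
  by apply: contra (adj x (Ordinal x1n) erefl) => /eqP ->; rewrite set0I.
(* Now [x] is the last index and its neighbour is the previous one; [2 <= n] excludes [x = 0]. *)
have x1 : x.-1 < n by exact: leq_ltn_trans (leq_pred _) (ltn_ord x).
have xE : x = x.-1.+1 :> nat by rewrite prednK // -ltnS; exact: leq_trans nx.
by apply: contra (adj (Ordinal x1) x xE) => /eqP ->; rewrite setI0.
Qed.

Lemma index_sig_ltn n (I : {set 'I_n * 'I_n}) x :
  index (signature I x) (block_sigs n I) < nblocks I.
Proof. by rewrite /nblocks -(size_map (signature I)) index_mem signature_in_block_sigs. Qed.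

Definition block_index n (I : {set 'I_n * 'I_n}) x : 'I_(nblocks I) :=
  Ordinal (index_sig_ltn n I x).

Lemma block_sig_index n (I : {set 'I_n * 'I_n}) x :
  block_sig I (block_index n I x) = signature I x.
Proof. exact/nth_index/signature_in_block_sigs. Qed.

Lemma block_indexE n (I : {set 'I_n * 'I_n}) x u :
  (block_index n I x == u) = (signature I x == block_sig I u).
Proof.
apply/eqP/eqP=> [<- | sE]; first by rewrite block_sig_index.
apply: val_inj; rewrite /= sE index_uniq ?uniq_block_sigs //.
by rewrite size_map ltn_ord.
Qed.

Lemma card_block n (I : {set 'I_n * 'I_n}) u :
  #|block I (u : 'I_(nblocks I))| = fibre_size n _ (block_index n I) u.
Proof.
rewrite fibre_sizeE; congr #|pred_of_set _|; apply/setP=> x.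
rewrite [RHS]inE block_indexE.
have [y _] : exists y : 'I_n, true by exists x.
by rewrite /block /block_sig !(nth_map y) ?ltn_ord // inE.
Qed.

Lemma block_sig_neq0 n (I : {set 'I_n * 'I_n}) (u : 'I_(nblocks I)) :
  2 <= n -> is_ideal I -> is_full (compl_ideal I) -> block_sig I u != set0.
Proof.
move=> n2 Iid full.
have : block_sig I u \in block_sigs n I by apply: mem_nth; rewrite size_map.
by case/mapP=> y _ ->; apply: signature_neq0.
Qed.

(** Blocks are adjacent when their signatures meet, so adjacency encodes membership in the
    complement of [I]; it is reflexive because signatures are nonempty. *)
Lemma card_monochromatic n (I : {set 'I_n * 'I_n}) p (f : 'I_n -> 'I_p) :
  2 <= n -> is_ideal I -> is_full (compl_ideal I) ->
  let a := fibre_size n _ (fun x => (block_index n I x, f x)) in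
  #|[set e in compl_ideal I | f e.1 == f e.2]|
  = \sum_u \sum_s ('C(a (u, s), 2) + a (u, s) * \sum_(v in Rset I u) a (v, s)).
Proof.
move=> n2 Iid full.
pose adj (u v : 'I_(nblocks I)) := block_sig I u :&: block_sig I v != set0.
have adjR : reflexive adj by move=> u; rewrite /adj setIid block_sig_neq0.
have adjS : symmetric adj by move=> u v; rewrite /adj setIC.
apply: etrans (count_monochromatic_pairs _ p n (block_index n I) f adj adjR adjS).
rewrite pair_big /= -sum1_card big_mkcond; apply: eq_bigr => -[x y] _ /=.
rewrite inE /= /adj !block_sig_index.
case: ltnP => [xy | yx]; first by rewrite compl_ideal_signature //; case: ifP.
by rewrite !inE /= ltnNge yx andbF.
Qed.

(** * Grouping the colourings by their counts per block and colour *)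

Theorem mainTheorem11 (R : realFieldType) (n : nat) (I : {set 'I_n * 'I_n})
    (p : nat) :
  (2 <= n)%N -> is_ideal I -> is_full (compl_ideal I) ->
  prime p -> odd p ->
  coboundary R (compl_ideal I) (p%:R)%R = rhs R I p.
Proof.
move=> n2 Iid full p_pr _.
rewrite (coboundary_colorings R _ _ _ (ltnW n2) (prime_gt0 p_pr) full).
congr (_ *: _)%R.
pose cnt (f : {ffun 'I_n -> 'I_p}) := fibre_size n _ (fun x => (block_index n I x, f x)).
have cnt_le f z : cnt f z <= n.
  by rewrite /cnt fibre_sizeE -[X in _ <= X]card_ord max_card.
(* The values lie in ['I_n.+1] to match the families summed in [rhs]; [inord] is exact by
   [cnt_le]. *)
pose counts f : {ffun 'I_(nblocks I) * 'I_p -> 'I_n.+1} := [ffun z => inord (cnt f z)].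
have countsE f z : counts f z = cnt f z :> nat by rewrite ffunE inordK // ltnS.
have sum_cnt f u : \sum_s cnt f (u, s) = fibre_size n _ (block_index n I) u.
  rewrite exchange_big; apply: eq_bigr => x _ /=.
  rewrite (bigD1 (f x)) //= xpair_eqE eqxx andbT big1 ?addn0 // => s /negPf sf.
  by rewrite xpair_eqE [f x == s]eq_sym sf andbF.
(* On each fibre of [counts] the exponent is constant, and the size of the fibre is a product of
   multinomial coefficients. *)
rewrite (partition_big counts
  (fun a => [forall u, \sum_(s < p) (a (u, s) : nat) == #|block I u|])) => [|f _].
  apply: eq_bigr => a /forallP aE.
  rewrite (eq_bigr (fun=> 'X^(\sum_(u < nblocks I) \sum_(s < p)
      ('C(a (u, s), 2) + a (u, s) * \sum_(v in Rset I u) (a (v, s) : nat))%N)%R)).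
    rewrite sumr_const -scaler_nat; congr (_%:R *: _)%R.
    under [RHS]eq_bigr do rewrite card_block.
    rewrite -(card_prescribed_fibres_multinom _ _ _ _ (fun z => a z : nat)) => [|u].
      apply: eq_card => f; rewrite [RHS]inE [LHS](_ : _ = (counts f == a)) //.
      apply/eqP/forallP => [<- z | fa].
        by rewrite countsE.
      by apply/ffunP=> z; apply: val_inj; rewrite /= countsE; apply/eqP/fa.
    by rewrite (eqP (aE u)) card_block.
  move=> f /eqP <-; rewrite card_monochromatic //; congr ('X^_)%R.
  apply: eq_bigr => u _; apply: eq_bigr => s _; rewrite !countsE; congr (_ + _ * _).
  by apply: eq_bigr => v _; rewrite countsE.
apply/forallP=> u; rewrite card_block -(sum_cnt f).
by apply/eqP/eq_bigr => s _; rewrite countsE.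
Qed.
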